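(* Let $M>m>0$ and let $f,g,h\in L^2_\phi(\Omega)$, with $h(x)\ne 0$ for almost every $x\in\Omega$, be such that the functions $$M\cdot\frac{g}{h}-\frac{f}{h},\qquad \frac{f}{h}-m\cdot\frac{g}{h}$$ are synchronous. Then $$0\le\left|\begin{matrix}\int_\Omega\phi f^2&\int_\Omega\phi fh\\ \int_\Omega\phi fh&\int_\Omega\phi h^2\end{matrix}\right|^{1/2}\left|\begin{matrix}\int_\Omega\phi g^2&\int_\Omega\phi gh\\ \int_\Omega\phi gh&\int_\Omega\phi h^2\end{matrix}\right|^{1/2}\le\frac12\cdot\frac{M+m}{\sqrt{mM}}\left|\begin{matrix}\int_\Omega\phi fg&\int_\Omega\phi fh\\ \int_\Omega\phi gh&\int_\Omega\phi h^2\end{matrix}\right| .$$ The constant $\frac12$ is best possible: there is no $C<\frac12$ such that the second inequality, with $\frac12$ replaced by $C$, holds for all measure spaces $(\Omega,\Sigma,\mu)$, all measurable $\phi:\Omega\to[0,\infty)$, all $M>m>0$ and all $f,g,h\in L^2_\phi(\Omega)$ with $h\ne0$ almost everywhere such that $M\cdot\frac{g}{h}-\frac{f}{h}$ and $\frac{f}{h}-m\cdot\frac{g}{h}$ are synchronous.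
   Context: $(\Omega,\Sigma,\mu)$ is a measure space consisting of a set $\Omega$, a $\sigma$-algebra $\Sigma$ of subsets of $\Omega$ and a countably additive positive measure $\mu$ on $\Sigma$ with values in $\mathbb{R}\cup\{\infty\}$; $\phi:\Omega\to[0,\infty)$ is a measurable function. $L^2_\phi(\Omega)$ denotes the Hilbert space of all real-valued measurable functions $f$ on $\Omega$ with $\int_\Omega\phi(s)|f(s)|^2\,d\mu(s)<\infty$. $\int_\Omega\phi fg$ abbreviates $\int_\Omega\phi(x)f(x)g(x)\,d\mu(x)$ (and similarly for the other integrals), and vertical bars around an array denote the determinant. A pair of real-valued functions $(q,p)$ on $\Omega$ is called synchronous if $(q(x)-q(y))(p(x)-p(y))\ge0$ for almost every $x,y\in\Omega$ (i.e. for $\mu$-almost every $x$, the inequality holds for $\mu$-almost every $y$). *)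

(* Defs.v *)
From HB Require Import structures.
From mathcomp Require Import all_boot all_order all_algebra.
From mathcomp Require Import all_classical all_reals all_analysis.

Set Implicit Arguments.
Unset Strict Implicit.
Unset Printing Implicit Defensive.

Import Order.TTheory GRing.Theory Num.Theory.
Import numFieldNormedType.Exports.

Local Open Scope classical_set_scope.
Local Open Scope ring_scope.

(* Elements of the weighted L^2 space are represented by functions rather than
   by classes modulo almost-everywhere equality. *)
Definition in_L2 (R : realType) (d : measure_display) (T : measurableType d)
    (mu : {measure set T -> \bar R}) (phi f : T -> R) : Prop :=
  measurable_fun [set: T] f /\
  (\int[mu]_x (phi x * `|f x| ^+ 2)%:E < +oo)%E.

(* The two null sets are iterated, the exceptional set of y depending on x: no
   product measure is involved, since mu need not be sigma-finite. *)
Definition synchronous (R : realType) (d : measure_display)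
    (T : measurableType d) (mu : {measure set T -> \bar R}) (q p : T -> R)
    : Prop :=
  {ae mu, forall x, {ae mu, forall y, 0 <= (q x - q y) * (p x - p y)}}.

Definition wint (R : realType) (d : measure_display) (T : measurableType d)
    (mu : {measure set T -> \bar R}) (phi f g : T -> R) : R :=
  \int[mu]_x (phi x * f x * g x).

Definition det2 (R : realType) (a b c d : R) : R :=
  \det (\matrix_(i < 2, j < 2)
    if i == 0 then (if j == 0 then a else b) else (if j == 0 then c else d)).

(* Main.v *)
Require Import Defs.
From HB Require Import structures.
From mathcomp Require Import all_boot all_order all_algebra.
From mathcomp Require Import all_classical all_reals all_analysis.
From mathcomp Require Import measurable_realfun ring lra.

Set Implicit Arguments.
Unset Strict Implicit.
Unset Printing Implicit Defensive.

Import Order.TTheory GRing.Theory Num.Theory.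
Import numFieldNormedType.Exports.

Local Open Scope classical_set_scope.
Local Open Scope ring_scope.

(** Write [<u,v>] for the weighted integral of [u v] and
    [gram u v w = <u,v><w,w> - <u,w><v,w>] for the determinants of the theorem.
    Everything rests on the Korkine-type identity
[[
  2 gram u v w = int int phi(x) phi(y) (u(x) w(y) - u(y) w(x))
                                       (v(x) w(y) - v(y) w(x)) dy dx,
]]
    by which [gram u v w] is nonnegative as soon as the product of the two
    brackets is, almost everywhere ([gram_ge0]).  The integrals are iterated,
    so that Fubini's theorem is not involved: the inner one is expanded by
    bilinearity, and then the outer one.

    The identity is used twice.  With [u = v] it is the Cauchy-Schwarz
    inequality [0 <= gram u u w].  With [u = M g - f] and [v = f - m g], the
    product of the brackets is [h(x)^2 h(y)^2] times the product that
    synchronicity assumes nonnegative; expanding the resulting inequality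
    gives
[[
  gram f f h + m M gram g g h <= (M + m) gram f g h,
]]
    and the arithmetic-geometric mean inequality bounds the left-hand side
    from below by [2 sqrt (m M) sqrt (gram f f h) sqrt (gram g g h)].

    For the optimality of 1/2, take [f = g] and [m = 1].  The second of the two
    functions is then zero, hence synchronous with any other, and the
    inequality with [C] for 1/2 reads [1 <= C (M + 1) / sqrt M] as soon as
    [gram g g h > 0], which two atoms suffice to realize.  The right-hand side
    tends to [2 C < 1] as [M] tends to 1. *)

(** * Preliminaries *)

Lemma det2E (R : realType) (a b c d : R) : det2 a b c d = a * d - b * c.
Proof.
rewrite /det2 (expand_det_row _ ord0) !big_ord_recl big_ord0 addr0.
by rewrite /cofactor !det_mx11 !mxE /= !mul1r; ring.
Qed.

(** The integral is that of the absolute value of [w], to which [w] is almost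
    everywhere equal. *)
Lemma Rintegral_ae_ge0 (R : realType) (d : measure_display)
    (T : measurableType d) (mu : {measure set T -> \bar R}) (w : T -> R) :
  measurable_fun [set: T] w -> {ae mu, forall x, 0 <= w x} ->
  0 <= \int[mu]_x w x.
Proof.
move=> mw w0.
have -> : \int[mu]_x w x = \int[mu]_x `|w x|.
  congr fine; apply: ae_eq_integral => //.
  - exact/measurable_EFinP.
  - by apply/measurable_EFinP; exact: measurableT_comp.
  - by apply: filterS w0 => x wx _; rewrite ger0_norm.
by apply: Rintegral_ge0 => x _; exact: normr_ge0.
Qed.

(** * The weighted inner product *)

Section WeightedL2.
Context (R : realType) (d : measure_display) (T : measurableType d).
Context (mu : {measure set T -> \bar R}) (phi : T -> R).
Hypotheses (mphi : measurable_fun [set: T] phi) (phi0 : forall x, 0 <= phi x).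
Implicit Types (u v w : T -> R) (a b : R).

Let mprod u v : in_L2 mu phi u -> in_L2 mu phi v ->
  measurable_fun [set: T] (fun x => phi x * u x * v x).
Proof.
by move=> [mu' _] [mv _]; apply: measurable_funM => //; exact: measurable_funM.
Qed.

Lemma integrable_sqr u : in_L2 mu phi u ->
  mu.-integrable [set: T] (EFin \o (fun x => phi x * u x * u x)).
Proof.
move=> L2u; have [_ u_fin] := L2u; apply/integrableP; split.
  by apply/measurable_EFinP; exact: mprod.
rewrite (eq_integral (fun x => (phi x * `|u x| ^+ 2)%:E)) // => x _ /=.
by rewrite -mulrA -expr2 -normrX normrM !ger0_norm ?sqr_ge0.
Qed.

(** The bound [|u v| <= u^2 + v^2] makes every weighted inner product finite,
    and is what allows linearity of the integral everywhere below. *)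
Lemma integrable_mul u v : in_L2 mu phi u -> in_L2 mu phi v ->
  mu.-integrable [set: T] (EFin \o (fun x => phi x * u x * v x)).
Proof.
move=> L2u L2v.
apply: le_integrable (integrableD measurableT (integrable_sqr L2u)
  (integrable_sqr L2v)) => //; first by apply/measurable_EFinP; exact: mprod.
move=> x _ /=; rewrite lee_fin -!mulrA -mulrDr !normrM ler_wpM2l //.
rewrite [leRHS]ger0_norm ?addr_ge0 -?expr2 ?sqr_ge0//.
rewrite -[u x ^+ 2]real_normK ?num_real// -[v x ^+ 2]real_normK ?num_real//.
have := sqr_ge0 (`|u x| - `|v x|); have := sqr_ge0 (`|u x| + `|v x|).
nra.
Qed.

Lemma in_L2_comb a b u v : in_L2 mu phi u -> in_L2 mu phi v ->
  in_L2 mu phi (fun x => a * u x + b * v x).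
Proof.
move=> L2u L2v; have mcomb : measurable_fun [set: T] (fun x => a * u x + b * v x).
  by apply: measurable_funD; apply: measurable_funM => //;
    [case: L2u|case: L2v].
split=> //.
(* (a u + b v)^2 <= 2 a^2 u^2 + 2 b^2 v^2, the difference being
   (a u - b v)^2. *)
set F := fun x => 2 * a ^+ 2 * (phi x * u x * u x) +
                  2 * b ^+ 2 * (phi x * v x * v x).
have iF : mu.-integrable [set: T] (EFin \o F).
  by apply: (integrableD _ (integrableZl _ (2 * a ^+ 2) (integrable_sqr L2u))
    (integrableZl _ (2 * b ^+ 2) (integrable_sqr L2v))).
have [_ +] := integrableP _ _ _ iF; apply: le_lt_trans.
apply: ge0_le_integral => //.
- by move=> x _; rewrite lee_fin mulr_ge0 ?sqr_ge0.
- apply/measurable_EFinP; apply: measurable_funM => //.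
  by apply: measurable_funX; exact: measurableT_comp.
- by apply: measurableT_comp => //; exact: measurable_int iF.
- move=> x _ /=; rewrite lee_fin (le_trans _ (ler_norm _))// /F.
  rewrite real_normK ?num_real//.
  have := mulr_ge0 (phi0 x) (sqr_ge0 (a * u x - b * v x)).
  nra.
Qed.

Lemma wintC u v : wint mu phi u v = wint mu phi v u.
Proof. by apply: eq_Rintegral => x _; ring. Qed.

Lemma wint_combr a b u v w :
  in_L2 mu phi u -> in_L2 mu phi v -> in_L2 mu phi w ->
  wint mu phi u (fun x => a * v x + b * w x) =
  a * wint mu phi u v + b * wint mu phi u w.
Proof.
move=> L2u L2v L2w; rewrite /wint.
rewrite -!RintegralZl -?RintegralD//; try exact: integrable_mul.
- by apply: eq_Rintegral => x _; ring.
- exact: (integrableZl _ a (integrable_mul L2u L2v)).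
- exact: (integrableZl _ b (integrable_mul L2u L2w)).
Qed.

Lemma wint_combl a b u v w :
  in_L2 mu phi u -> in_L2 mu phi v -> in_L2 mu phi w ->
  wint mu phi (fun x => a * v x + b * w x) u =
  a * wint mu phi v u + b * wint mu phi w u.
Proof.
by move=> L2u L2v L2w; rewrite wintC wint_combr// (wintC u v) (wintC u w).
Qed.

(** * The Gram-type determinant and synchronicity *)

(** For [<w,w> > 0] this is [<w,w>] times the inner product of the components of
    [u] and [v] orthogonal to [w]; hence its bilinearity in [u] and [v]. *)
Definition gram u v w : R :=
  det2 (wint mu phi u v) (wint mu phi u w) (wint mu phi v w) (wint mu phi w w).

Lemma gramE u v w : gram u v w =
  wint mu phi u v * wint mu phi w w - wint mu phi u w * wint mu phi v w.
Proof. exact: det2E. Qed.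

(** The Korkine-type identity, in the form of an inequality.  For fixed [x] the
    integrand in [y] is [phi] times a product of two combinations of [w] with
    [u] and with [v], so its integral is a weighted inner product; what results
    is, as a function of [x], a combination of [u v], [u w], [v w] and [w^2],
    whose weighted integral is [2 gram u v w]. *)
Lemma gram_ge0 u v w :
  in_L2 mu phi u -> in_L2 mu phi v -> in_L2 mu phi w ->
  {ae mu, forall x, {ae mu, forall y,
    0 <= (u x * w y - u y * w x) * (v x * w y - v y * w x)}} ->
  0 <= gram u v w.
Proof.
move=> L2u L2v L2w sync.
have [mu' mv mw] : [/\ measurable_fun [set: T] u, measurable_fun [set: T] v &
  measurable_fun [set: T] w] by split; [case: L2u|case: L2v|case: L2w].
have inner x : {ae mu, forall y,
    0 <= (u x * w y - u y * w x) * (v x * w y - v y * w x)} ->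
  0 <= u x * v x * wint mu phi w w - u x * w x * wint mu phi v w
       - w x * v x * wint mu phi u w + w x * w x * wint mu phi u v.
  move=> syncx.
  have L2A : in_L2 mu phi (fun y => u x * w y + (- w x) * u y).
    exact: in_L2_comb.
  have L2B : in_L2 mu phi (fun y => v x * w y + (- w x) * v y).
    exact: in_L2_comb.
  have : 0 <= wint mu phi (fun y => u x * w y + (- w x) * u y)
                          (fun y => v x * w y + (- w x) * v y).
    apply: Rintegral_ae_ge0; first exact: mprod.
    apply: filterS syncx => y xy; rewrite -mulrA mulr_ge0//.
    by rewrite !mulNr ![w x * _]mulrC.
  rewrite wint_combr// !wint_combl// (wintC w v).
  by congr (0 <= _); ring.
set ww := wint mu phi w w in inner *; set vw := wint mu phi v w in inner *.
set uw := wint mu phi u w in inner *; set uv := wint mu phi u v in inner *.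
have L2P : in_L2 mu phi (fun x => ww * v x + (- vw) * w x).
  exact: in_L2_comb.
have L2Q : in_L2 mu phi (fun x => uv * w x + (- uw) * v x).
  exact: in_L2_comb.
(* The function of [x] is regrouped as [u] times a combination of [v] and [w]
   plus [w] times another one, to apply bilinearity again. *)
have : 0 <= wint mu phi u (fun x => ww * v x + (- vw) * w x) +
            wint mu phi w (fun x => uv * w x + (- uw) * v x).
  rewrite /wint -RintegralD//; try exact: integrable_mul.
  apply: Rintegral_ae_ge0.
    by apply: measurable_funD; exact: mprod.
  apply: filterS sync => x /inner xge0.
  have := mulr_ge0 (phi0 x) xge0.
  by congr (0 <= _); ring.
rewrite !wint_combr// (wintC w v) -/uv -/uw -/vw -/ww => H.
rewrite gramE -/uv -/ww -/uw -/vw.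
by nra.
Qed.

(** Cauchy-Schwarz: the two brackets of [gram_ge0] coincide.  This route also
    covers [<w,w> = 0], where the usual discriminant argument degenerates. *)
Lemma gram_diag_ge0 u w : in_L2 mu phi u -> in_L2 mu phi w -> 0 <= gram u u w.
Proof.
move=> L2u L2w; apply: gram_ge0 => //.
by apply: aeW => x; apply: aeW => y; rewrite -expr2 sqr_ge0.
Qed.

(** Clearing the denominators [h(x)] and [h(y)] turns synchronicity into the
    nonnegativity of the product of brackets for [M g - f] and [f - m g]; the
    conclusion is the bilinear expansion of
    [0 <= gram (M g - f) (f - m g) h]. *)
Lemma synchronous_gram_le (M m : R) f g h :
  in_L2 mu phi f -> in_L2 mu phi g -> in_L2 mu phi h ->
  {ae mu, forall x, h x != 0} ->
  synchronous mu (fun x => M * (g x / h x) - f x / h x)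
                 (fun x => f x / h x - m * (g x / h x)) ->
  gram f f h + m * M * gram g g h <= (M + m) * gram f g h.
Proof.
move=> L2f L2g L2h h0 sync.
have L2A : in_L2 mu phi (fun x => M * g x + (-1) * f x) by exact: in_L2_comb.
have L2B : in_L2 mu phi (fun x => 1 * f x + (- m) * g x) by exact: in_L2_comb.
have : 0 <= gram (fun x => M * g x + (-1) * f x)
                 (fun x => 1 * f x + (- m) * g x) h.
  apply: gram_ge0 => //.
  apply: filterS2 (h0) sync => x hx; apply: filterS2 h0 => y hy xy.
  have := mulr_ge0 xy (mulr_ge0 (sqr_ge0 (h x)) (sqr_ge0 (h y))).
  by congr (0 <= _); field; rewrite hx hy.
rewrite !gramE wint_combr// !wint_combl// (wintC g f).
by lra.
Qed.

End WeightedL2.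

(** The arithmetic-geometric mean inequality for [F] and [m M G]. *)
Lemma sqrt_prod_le (R : realType) (F G K M m : R) : 0 < m -> 0 < M ->
  0 <= F -> 0 <= G -> F + m * M * G <= (M + m) * K ->
  Num.sqrt F * Num.sqrt G <= 2^-1 * ((M + m) / Num.sqrt (m * M)) * K.
Proof.
move=> m0 M0 F0 G0 FGK.
have s0 : 0 < Num.sqrt (m * M) by rewrite sqrtr_gt0 mulr_gt0.
rewrite (_ : _ * K = 2^-1 * ((M + m) * K) / Num.sqrt (m * M)); last by ring.
rewrite ler_pdivlMr// ler_pdivlMl//; apply: le_trans FGK.
rewrite -[in leRHS](sqr_sqrtr F0) -[in leRHS](sqr_sqrtr G0).
rewrite -[in leRHS](@sqr_sqrtr _ (m * M)); last exact: ltW (mulr_gt0 _ _).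
have := sqr_ge0 (Num.sqrt F - Num.sqrt (m * M) * Num.sqrt G).
nra.
Qed.

(** * Optimality of the constant *)

Section TwoPoints.
Context (R : realType).

Definition two_points : {measure set bool -> \bar R} :=
  measure_add (dirac true) (dirac false).

Lemma integral_two_points (w : bool -> R) : (forall b, 0 <= w b) ->
  (\int[two_points]_b (w b)%:E = (w true + w false)%:E)%E.
Proof.
move=> w0; rewrite ge0_integral_measure_add//; last by move=> b _; rewrite lee_fin.
by rewrite !integral_dirac// !diracT !mul1e.
Qed.

Lemma in_L2_two_points (w : bool -> R) : in_L2 two_points (cst 1) w.
Proof.
split=> //.
rewrite integral_two_points ?ltry// => b.
by rewrite mul1r sqr_ge0.
Qed.

Lemma wint_two_points (u v : bool -> R) : (forall b, 0 <= u b * v b) ->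
  wint two_points (cst 1) u v = u true * v true + u false * v false.
Proof.
move=> uv0; rewrite /wint /Rintegral integral_two_points /= ?mul1r// => b.
by rewrite mul1r.
Qed.

(** One of the simplest pairs that are not proportional: the indicator function
    of an atom and the constant 1, with Gram matrix [(1, 1; 1, 2)]. *)
Lemma gram_two_points :
  let g := fun b : bool => b%:R : R in
  gram two_points (cst 1) g g (cst 1) = 1.
Proof.
move=> g; have g0 b : 0 <= g b by rewrite /g ler0n.
rewrite gramE !wint_two_points /g /=; try by move=> b; rewrite ?mulr1 ?mulr_ge0.
ring.
Qed.

End TwoPoints.

(** The ratio [(M + 1) / sqrt M] tends to 2 as [M] decreases to 1.  Explicitly,
    replace [C] by [c = max C (1/4)] to keep it positive and take
    [M = 1 / (2 c)], so that [M > 1] and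
    [c (M + 1) = 1/2 + c < 1 < sqrt M]. *)
Lemma exists_ratio_lt (R : realType) (C : R) : C < 2^-1 ->
  exists M : R, 1 < M /\ C * ((M + 1) / Num.sqrt (1 * M)) < 1.
Proof.
move=> C2; pose c := Num.max C 4^-1.
have c0 : 0 < c by rewrite lt_max; apply/orP; right; lra.
have c2 : c < 2^-1 by rewrite gt_max C2; lra.
have Cc : C <= c by rewrite le_max lexx.
have M1 : 1 < (2 * c)^-1 by rewrite invf_gt1; lra.
exists (2 * c)^-1; split=> //; rewrite mul1r.
set M := (2 * c)^-1 in M1 *.
have cM : c * M = 2^-1 by rewrite /M; field; lra.
have s1 : 1 < Num.sqrt M by rewrite -[ltLHS]sqrtr1 ltr_sqrt; lra.
rewrite mulrA ltr_pdivrMr; last by lra.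
rewrite mul1r (le_lt_trans _ s1)// (@le_trans _ _ (c * (M + 1)))//; last by lra.
by rewrite ler_wpM2r//; lra.
Qed.
Theorem proposition3p2 (R : realType) :
  (forall (d : measure_display) (T : measurableType d)
      (mu : {measure set T -> \bar R}) (phi : T -> R) (M m : R)
      (f g h : T -> R),
    measurable_fun [set: T] phi -> (forall x, 0 <= phi x) ->
    0 < m -> m < M ->
    in_L2 mu phi f -> in_L2 mu phi g -> in_L2 mu phi h ->
    {ae mu, forall x, h x != 0} ->
    synchronous mu (fun x => M * (g x / h x) - f x / h x)
                   (fun x => f x / h x - m * (g x / h x)) ->
    0 <= Num.sqrt (det2 (wint mu phi f f) (wint mu phi f h)
                        (wint mu phi f h) (wint mu phi h h)) *
         Num.sqrt (det2 (wint mu phi g g) (wint mu phi g h)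
                        (wint mu phi g h) (wint mu phi h h)) /\
    Num.sqrt (det2 (wint mu phi f f) (wint mu phi f h)
                   (wint mu phi f h) (wint mu phi h h)) *
    Num.sqrt (det2 (wint mu phi g g) (wint mu phi g h)
                   (wint mu phi g h) (wint mu phi h h)) <=
    2^-1 * ((M + m) / Num.sqrt (m * M)) *
    det2 (wint mu phi f g) (wint mu phi f h)
         (wint mu phi g h) (wint mu phi h h)) /\
  ~ (exists C : R, C < 2^-1 /\
      forall (d : measure_display) (T : measurableType d)
        (mu : {measure set T -> \bar R}) (phi : T -> R) (M m : R)
        (f g h : T -> R),
      measurable_fun [set: T] phi -> (forall x, 0 <= phi x) ->
      0 < m -> m < M ->
      in_L2 mu phi f -> in_L2 mu phi g -> in_L2 mu phi h ->
      {ae mu, forall x, h x != 0} ->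
      synchronous mu (fun x => M * (g x / h x) - f x / h x)
                     (fun x => f x / h x - m * (g x / h x)) ->
      Num.sqrt (det2 (wint mu phi f f) (wint mu phi f h)
                     (wint mu phi f h) (wint mu phi h h)) *
      Num.sqrt (det2 (wint mu phi g g) (wint mu phi g h)
                     (wint mu phi g h) (wint mu phi h h)) <=
      C * ((M + m) / Num.sqrt (m * M)) *
      det2 (wint mu phi f g) (wint mu phi f h)
           (wint mu phi g h) (wint mu phi h h)).
Proof.
split.
  move=> d T mu phi M m f g h mphi phi0 m0 mM L2f L2g L2h h0 sync.
  split; first by rewrite mulr_ge0 ?sqrtr_ge0.
  apply: sqrt_prod_le => //; first exact: lt_trans mM.
  - exact: (gram_diag_ge0 mphi phi0).
  - exact: (gram_diag_ge0 mphi phi0).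
  - exact: (synchronous_gram_le mphi phi0).
move=> [C [C2 bound]].
have [M [M1 CM]] := exists_ratio_lt C2.
pose g := fun b : bool => b%:R : R.
have m1 : measurable_fun [set: bool] (cst 1 : bool -> R) by [].
have := bound _ _ (two_points R) (cst 1) M 1 g g (cst 1).
move=> /(_ m1 (fun=> ler01) ltr01 M1
  (in_L2_two_points _) (in_L2_two_points _) (in_L2_two_points _)).
have h1 : {ae two_points R, forall b, cst 1 b != 0 :> R}.
  by apply: aeW => b; exact: oner_neq0.
move=> /(_ h1); rewrite -/(gram _ _ g g (cst 1)) gram_two_points.
rewrite sqrtr1 !mulr1 => H.
suff /H : synchronous (two_points R) (fun b => M * (g b / cst 1 b) - g b / cst 1 b)
    (fun b => g b / cst 1 b - 1 * (g b / cst 1 b)) by rewrite leNgt CM.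
by apply: aeW => x; apply: aeW => y; rewrite !mul1r !subrr mulr0.
Qed.
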